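(* Let $I$ be a radical right ideal of $\mathbb{H}[q_1,\ldots,q_n]$ such that $\mathcal{V}_c(I)$ is irreducible. Then $I$ is a quasi prime ideal.
   Context: $\mathbb{H}$ is the skew field of quaternions, $\mathbb{S}=\{J\in\mathbb{H}: J^2=-1\}$, and for $K\in\mathbb{S}$, $\mathbb{C}_K=\mathbb{R}+\mathbb{R}K$. $\mathbb{H}[q_1,\ldots,q_n]$ is the set of slice regular polynomials, i.e. functions $P:\mathbb{H}^n\to\mathbb{H}$, $P(q_1,\ldots,q_n)=\sum q_1^{\ell_1}\cdots q_n^{\ell_n}a_{\ell_1,\ldots,\ell_n}$ (finite sum, variables in this order, coefficients in $\mathbb{H}$ on the right). It is a ring under pointwise sum and the $*$-product determined by $(q^{\ell}a)*(q^{m}b)=q^{\ell+m}ab$ for multi-indices $\ell,m$, where $q^\ell=q_1^{\ell_1}\cdots q_n^{\ell_n}$. For a right ideal $I$, $\mathcal{V}(I)\subseteq\mathbb{H}^n$ is the set of common zeros of all $P\in I$, and $\mathcal{V}_c(I)=\mathcal{V}(I)\cap\bigcup_{K\in\mathbb{S}}\mathbb{C}_K^n$. The regular conjugate of $P=\sum q^\ell a_\ell$ is $P^c=\sum q^\ell\,\overline{a_\ell}$; the symmetrization of $P$ is $P^s=P*P^c=P^c*P$. A right ideal $J$ is completely prime if, whenever $P*Q\in J$ and $P*J\subseteq J$, either $P\in J$ or $Q\in J$. The radical $\sqrt{I}$ of a right ideal $I$ is the intersection of all completely prime right ideals containing $I$; $I$ is radical if $\sqrt{I}=I$. A right ideal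 $I$ is quasi prime if, whenever $P*Q\in I$, either $P\in I$ or $Q^s\in I$. A set $\mathcal{V}_c(I)$ is reducible if there exist proper, non-trivial right ideals $I_1,I_2$ of $\mathbb{H}[q_1,\ldots,q_n]$ with $\mathcal{V}_c(I)=\mathcal{V}_c(I_1)\cup\mathcal{V}_c(I_2)$, where neither of $\mathcal{V}_c(I_1),\mathcal{V}_c(I_2)$ is contained in the other; otherwise it is irreducible. *)

(* Defs.v *)
From HB Require Import structures.
From mathcomp Require Import all_boot all_order all_algebra ring.
From mathcomp Require Import boolp classical_sets reals mpoly.

Set Implicit Arguments.
Unset Strict Implicit.
Unset Printing Implicit Defensive.

Import Order.TTheory GRing.Theory Num.Theory.

Local Open Scope classical_set_scope.
Local Open Scope ring_scope.

(** * Quaternions *)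

(* [Quat a b c d] is a + b i + c j + d k. *)
Record quat (R : realType) : Type := Quat { qr : R; qi : R; qj : R; qk : R }.

Section QuatRing.
Variable R : realType.
Implicit Types x y z : quat R.

Lemma quat_eqP x y :
  qr x = qr y -> qi x = qi y -> qj x = qj y -> qk x = qk y -> x = y.
Proof. by case: x => ? ? ? ?; case: y => ? ? ? ? /= -> -> -> ->. Qed.

Definition tuple_of_quat x : R * R * R * R := (qr x, qi x, qj x, qk x).
Definition quat_of_tuple (t : R * R * R * R) : quat R :=
  Quat t.1.1.1 t.1.1.2 t.1.2 t.2.

Lemma tuple_of_quatK : cancel tuple_of_quat quat_of_tuple.
Proof. by case. Qed.

HB.instance Definition _ := Choice.copy (quat R) (can_type tuple_of_quatK).

Definition quat0 : quat R := Quat 0 0 0 0.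
Definition quatN x : quat R := Quat (- qr x) (- qi x) (- qj x) (- qk x).
Definition quatD x y : quat R :=
  Quat (qr x + qr y) (qi x + qi y) (qj x + qj y) (qk x + qk y).

Lemma quatDA : associative quatD.
Proof. by move=> x y z; apply: quat_eqP; rewrite /= addrA. Qed.
Lemma quatDC : commutative quatD.
Proof. by move=> x y; apply: quat_eqP; rewrite /= addrC. Qed.
Lemma quat0D : left_id quat0 quatD.
Proof. by move=> x; apply: quat_eqP; rewrite /= add0r. Qed.
Lemma quatND : left_inverse quat0 quatN quatD.
Proof. by move=> x; apply: quat_eqP; rewrite /= addNr. Qed.

HB.instance Definition _ :=
  GRing.isZmodule.Build (quat R) quatDA quatDC quat0D quatND.

Definition quat1 : quat R := Quat 1 0 0 0.
Definition quatM x y : quat R := Quat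
  (qr x * qr y - qi x * qi y - qj x * qj y - qk x * qk y)
  (qr x * qi y + qi x * qr y + qj x * qk y - qk x * qj y)
  (qr x * qj y - qi x * qk y + qj x * qr y + qk x * qi y)
  (qr x * qk y + qi x * qj y - qj x * qi y + qk x * qr y).

Lemma quatMA : associative quatM.
Proof. by move=> x y z; apply: quat_eqP => /=; ring. Qed.
Lemma quat1M : left_id quat1 quatM.
Proof. by move=> x; apply: quat_eqP => /=; ring. Qed.
Lemma quatM1 : right_id quat1 quatM.
Proof. by move=> x; apply: quat_eqP => /=; ring. Qed.
Lemma quatMDl : left_distributive quatM quatD.
Proof. by move=> x y z; apply: quat_eqP => /=; ring. Qed.
Lemma quatMDr : right_distributive quatM quatD.
Proof. by move=> x y z; apply: quat_eqP => /=; ring. Qed.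
Lemma quat1_neq0 : quat1 != 0.
Proof. by apply/eqP => -[] /eqP; rewrite oner_eq0. Qed.

HB.instance Definition _ := GRing.Zmodule_isNzRing.Build (quat R)
  quatMA quat1M quatM1 quatMDl quatMDr quat1_neq0.

Definition quat_conj x : quat R := Quat (qr x) (- qi x) (- qj x) (- qk x).
Definition quat_sqnorm x : R := qr x ^+ 2 + qi x ^+ 2 + qj x ^+ 2 + qk x ^+ 2.
Definition quatV x : quat R :=
  let s := quat_sqnorm x in
  Quat (qr x / s) (- qi x / s) (- qj x / s) (- qk x / s).

Lemma quat_sqnorm_eq0 x : (quat_sqnorm x == 0) = (x == 0).
Proof.
apply/idP/eqP => [|->]; last by rewrite /quat_sqnorm /= !expr0n /= !addr0.
rewrite /quat_sqnorm !paddr_eq0 ?addr_ge0 ?sqr_ge0 // !sqrf_eq0.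
by move=> /andP[/andP[/andP[/eqP ? /eqP ?] /eqP ?] /eqP ?]; apply: quat_eqP.
Qed.

Definition quat_unit : pred (quat R) := fun x => x != 0.

Lemma quatVM : {in quat_unit, left_inverse 1 quatV *%R}.
Proof.
move=> x; rewrite -topredE /= /quat_unit -quat_sqnorm_eq0 => x0.
by apply: quat_eqP => /=; move: x0; rewrite /quat_sqnorm => x0; field.
Qed.

Lemma quatMV : {in quat_unit, right_inverse 1 quatV *%R}.
Proof.
move=> x; rewrite -topredE /= /quat_unit -quat_sqnorm_eq0 => x0.
by apply: quat_eqP => /=; move: x0; rewrite /quat_sqnorm => x0; field.
Qed.

Lemma quat_unitP x y : y * x = 1 /\ x * y = 1 -> quat_unit x.
Proof.
case=> yx1 _; apply/eqP => x0; move: yx1; rewrite x0 mulr0 => /eqP.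
by rewrite eq_sym oner_eq0.
Qed.

Lemma quatV_out : {in [predC quat_unit], quatV =1 id}.
Proof.
move=> x; rewrite inE /= -topredE /= negbK => /eqP ->.
by apply: quat_eqP; rewrite /= ?oppr0 mul0r.
Qed.

HB.instance Definition _ := GRing.NzRing_hasMulInverse.Build (quat R)
  quatVM quatMV quat_unitP quatV_out.

Definition quat_real (a : R) : quat R := Quat a 0 0 0.

Definition quat_sphere : set (quat R) := [set J | J ^+ 2 = -1].

Definition quat_slice (K : quat R) : set (quat R) :=
  [set x | exists a b : R, x = quat_real a + quat_real b * K].

End QuatRing.

(** * Slice regular polynomials *)

(* A slice regular polynomial is represented by its family of coefficients;
   over the infinite central subfield R of H, distinct families give distinct
   functions.  In {mpoly H[n]} the indeterminates commute with each other and
   with the coefficients, so its product is the *-product,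
   (q^l a) * (q^m b) = q^(l+m) (a b), and the pointwise sum is its sum. *)
Notation slice_poly R n := {mpoly (quat R)[n]}.

Section SlicePoly.
Variables (R : realType) (n : nat).
Implicit Types (P Q : slice_poly R n) (q : 'I_n -> quat R).
Implicit Types I J : set (slice_poly R n).

(* The value of P at q: the product over 'I_n is taken from left to right in
   increasing order, and the coefficient is on the right. *)
Definition slice_eval P q : quat R :=
  \sum_(m <- msupp P) (\prod_(i < n) q i ^+ m i) * P@_m.

Definition reg_conj P : slice_poly R n :=
  \sum_(m <- msupp P) quat_conj P@_m *: 'X_[m].

Definition symmetrization P : slice_poly R n := P * reg_conj P.

(** * Right ideals *)

Definition right_ideal I : Prop :=
  [/\ I 0, forall P Q, I P -> I Q -> I (P + Q)
         & forall P Q, I P -> I (P * Q)].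

Definition completely_prime J : Prop :=
  forall P Q, J (P * Q) -> (forall S, J S -> J (P * S)) -> J P \/ J Q.

Definition ideal_radical I : set (slice_poly R n) :=
  \bigcap_(J in [set J | right_ideal J /\ completely_prime J /\ I `<=` J]) J.

Definition is_radical I : Prop := ideal_radical I = I.

Definition quasi_prime I : Prop :=
  forall P Q, I (P * Q) -> I P \/ I (symmetrization Q).

(** * Zero sets *)

Definition zero_set I : set ('I_n -> quat R) :=
  [set q | forall P, I P -> slice_eval P q = 0].

Definition slice_zero_set I : set ('I_n -> quat R) :=
  zero_set I `&`
  \bigcup_(K in @quat_sphere R) [set q | forall i, quat_slice K (q i)].

Definition proper_nontrivial I : Prop := I <> setT /\ I <> [set 0].

Definition reducible (V : set ('I_n -> quat R)) : Prop :=
  exists I1 I2, [/\ right_ideal I1 /\ proper_nontrivial I1,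
    right_ideal I2 /\ proper_nontrivial I2,
    V = slice_zero_set I1 `|` slice_zero_set I2,
    ~ (slice_zero_set I1 `<=` slice_zero_set I2)
    & ~ (slice_zero_set I2 `<=` slice_zero_set I1)].

Definition irreducible (V : set ('I_n -> quat R)) : Prop := ~ reducible V.

End SlicePoly.

(* Main.v *)
Require Import Defs.
From HB Require Import structures.
From mathcomp Require Import all_boot all_order all_algebra.
From mathcomp Require Import classical_sets reals mpoly.
From mathcomp Require Import boolp complex ring lra zify.

(** Write [V] for the slice zero set of [I], and suppose [P * Q] lies in [I].
At a point [q] of [V], the coordinates of [q] lie in one copy of the complex
numbers, and [(P * Q)(q) = P(q) Q(P(q)^-1 q P(q))] when [P(q)] is nonzero.  So
either [P(q) = 0], or [Q] vanishes at a conjugate of [q]; in the second case the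
symmetrization [Q^s] vanishes at that conjugate, and, having real coefficients,
also at [q] ([slice_eval_symmetrization]).  Hence [V] is the union of the slice
zero sets of the right ideals obtained from [I] by adjoining [P] and [Q^s].
Irreducibility makes one of the two contain the other, so [P] or [Q^s] vanishes
on all of [V], and it remains to know that a radical right ideal contains every
polynomial that vanishes on its slice zero set ([radical_eq_vanishing]).

This Nullstellensatz says that if [P] is outside a completely prime right ideal
[J], some point of the slice zero set of [J] is not a zero of [P]
([completely_prime_point]).  The real polynomials are central, so those lying in
[J] form a prime ideal [p] of the ordinary real polynomial ring.  Complex points
of [p] are plentiful ([mpoly_nullstellensatz]): outside [p] every polynomial is
nonzero at some complex zero of [p].  Over such a point [z] the slice polynomials
specialize to the algebra of complexified quaternions [x + iota y], and each
imaginary unit [K] turns [z] into a point of H^n at which evaluation is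
[x + iota y |-> x + K y] ([slice_eval_embed]).  Let [M] be the polynomials whose
four real components are in [p].
- If [J] is contained in [M], then all of [J] specializes to zero at [z], and it
  suffices that [P] does not, for a suitable [K] ([separating_slice]).
- Otherwise [J] contains [T] whose real part is not in [p], while its norm
  [T T^c] is in [p].  Over the fraction field of the quotient by [p] the
  quaternion algebra splits and [J] becomes the minimal right ideal generated by
  [T]; concretely, [S] is in [J] exactly when [T^c S] is in [M].  At a zero [z] of
  [p] at which [T^c P] is not zero, [T^c] specializes to an isotropic
  complexified quaternion, whose right annihilator is the kernel of the
  evaluation for a unique [K] ([isotropic_slice]).

The Nullstellensatz over the complex numbers is proved one variable at a time:
a homomorphism to an algebraically closed field extends from a ring to its
polynomial ring, respecting a prime ideal upstairs, as soon as it does not kill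
one well chosen element downstairs ([prime_ideal_extend]). *)

Set Implicit Arguments.
Unset Strict Implicit.
Unset Printing Implicit Defensive.

Import Order.TTheory GRing.Theory Num.Theory.

Local Open Scope classical_set_scope.
Local Open Scope ring_scope.

(* In the ring library these names stand for the parts of a number in a closed
   field; here they are the projections of R[i]. *)
Local Notation Re := complex.Re.
Local Notation Im := complex.Im.

(** * Prime ideals and extension of specializations *)

(** The unit ideal counts as prime. *)
Record prime_ideal (A : comNzRingType) (p : set A) : Prop := PrimeIdeal {
  prime0 : p 0;
  primeD : forall a b, p a -> p b -> p (a + b);
  primeM : forall a b, p a -> p (a * b);
  primeP : forall a b, p (a * b) -> p a \/ p b }.

Section PrimeIdealTheory.
Variables (A : comNzRingType) (p : set A).
Hypothesis pr_p : prime_ideal p.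

Lemma primeMl a b : p b -> p (a * b).
Proof. by rewrite mulrC; apply: primeM. Qed.

Lemma primeN a : p a -> p (- a).
Proof. by rewrite -mulN1r; apply: primeMl. Qed.

Lemma primeB a b : p a -> p b -> p (a - b).
Proof. by move=> pa pb; apply: primeD => //; apply: primeN. Qed.

Lemma primeX a k : ~ p 1 -> p (a ^+ k) -> p a.
Proof.
by move=> p1; elim: k => [|k IHk]; rewrite ?expr0 // exprS => /(primeP pr_p)[].
Qed.

Lemma prime_sum (J : Type) (r : seq J) (P : pred J) (F : J -> A) :
  (forall i, P i -> p (F i)) -> p (\sum_(i <- r | P i) F i).
Proof. by move=> pF; apply: big_ind => //; [exact: prime0 | exact: primeD]. Qed.

End PrimeIdealTheory.

Lemma prime_preim (A B : comNzRingType) (h : {rmorphism A -> B}) (p : set B) :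
  prime_ideal p -> prime_ideal (h @^-1` p).
Proof.
move=> pr_p; split=> [|a b|a b|a b] /=; rewrite ?rmorph0 ?rmorphD ?rmorphM.
- exact: prime0.
- exact: primeD.
- exact: primeM.
- exact: primeP.
Qed.

(** The last bound gives [s] the degree it has over a domain, although the leading
coefficient of [w] may be a zero divisor. *)
Lemma pseudo_division (A : comNzRingType) (w m : {poly A}) : w != 0 ->
  exists k s r, [/\ (lead_coef w ^+ k)%:P * m = s * w + r,
    (size r < size w)%N & (size s + size w <= maxn (size m).+1 (size w))%N].
Proof.
move=> w0; have wgt0 : (0 < size w)%N by rewrite size_poly_gt0.
have [N] := ubnP (size m); elim: N m => // N IHN m; rewrite ltnS => leN.
have [ltmw|lewm] := ltnP (size m) (size w).
  exists 0, 0, m; rewrite expr0 mul1r mul0r add0r size_poly0; split=> //; lia.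
set e := lead_coef w; set d := (size m - size w)%N.
set m1 := e%:P * m - (lead_coef m)%:P * 'X^d * w.
have szm1 : (size m1 < size m)%N.
  have szl : (size ((lead_coef m)%:P * 'X^d * w)%R <= size m)%N.
    have := @size_polyMleq _ ((lead_coef m)%:P * 'X^d) w.
    have := @size_polyMleq _ (lead_coef m)%:P 'X^d.
    have := @size_polyC_leq1 _ (lead_coef m).
    by rewrite size_polyXn /d; lia.
  have szm1 : (size m1 <= size m)%N.
    rewrite (leq_trans (size_polyD _ _)) // geq_max size_polyN szl andbT.
    by rewrite mul_polyC size_scale_leq.
  have cm1 : m1`_(size m).-1 = 0.
    rewrite coefB coefCM -mulrA coefCM ['X^d * w]mulrC coefMXn.
    have -> : ((size m).-1 < d)%N = false by rewrite /d; lia.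
    have -> : ((size m).-1 - d)%N = (size w).-1 by rewrite /d; lia.
    by rewrite -!lead_coefE mulrC addrN.
  rewrite ltn_neqAle szm1 andbT; apply/eqP => eqsz.
  have : lead_coef m1 = 0 by rewrite lead_coefE eqsz.
  by move/eqP; rewrite lead_coef_eq0 -size_poly_eq0 eqsz; lia.
have [k [s [r [eqm ltr les]]]] := IHN m1 (leq_trans szm1 leN).
exists k.+1, (s + (e ^+ k * lead_coef m)%:P * 'X^d), r; split=> //.
  rewrite exprS mulrC rmorphM /= mulrDl addrAC -eqm /m1 !rmorphM /=.
  by rewrite /e; ring.
have sz1 : (size ((e ^+ k * lead_coef m)%:P * 'X^d)%R <= d.+1)%N.
  have := @size_polyMleq _ (e ^+ k * lead_coef m)%:P 'X^d.
  have := @size_polyC_leq1 _ (e ^+ k * lead_coef m).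
  by rewrite size_polyXn; lia.
have le2 : (maxn (size s) d.+1 + size w <= maxn (size m).+1 (size w))%N.
  by move: les szm1; rewrite /d; lia.
apply: leq_trans le2; rewrite leq_add2r (leq_trans (size_polyD _ _)) //.
by rewrite geq_max leq_maxl /= (leq_trans sz1) // leq_maxr.
Qed.

Lemma min_size_poly (A : nzRingType) (D : set {poly A}) :
  D !=set0 -> exists2 m, D m & forall g, D g -> (size m <= size g)%N.
Proof.
case=> g0 Dg0.
have ex : exists k, `[< exists2 g, D g & size g = k >].
  by exists (size g0); apply/asboolP; exists g0.
case: (ex_minnP ex) => k /asboolP[m Dm <-] mink; exists m => // g Dg.
by apply: mink; apply/asboolP; exists g.
Qed.

Section OneVariable.
Variables (A : comNzRingType) (q : set {poly A}).
Hypothesis pr_q : prime_ideal q.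

Let p : set A := [set a | q a%:P].
Let pX : set {poly A} := [set g | forall i, p g`_i].

Let pr_p : prime_ideal p.
Proof. exact: (prime_preim (polyC : {rmorphism A -> {poly A}})). Qed.

Let pX_q g : pX g -> q g.
Proof.
move=> pXg; rewrite -[g]coefK poly_def; apply: prime_sum => // i _.
by rewrite -mul_polyC; apply: primeM => //; apply: pXg.
Qed.

Let pXD g h : pX g -> pX h -> pX (g + h).
Proof. by move=> pg ph i; rewrite coefD; apply: primeD. Qed.

Let pXM g h : pX g -> pX (g * h).
Proof.
by move=> pg i; rewrite coefM; apply: prime_sum => // j _; apply: primeM.
Qed.

(** Polynomials with coefficients in [p] can be subtracted without leaving [D], so
in an element of least degree the leading coefficient survives modulo [p]. *)
Let min_lead (D : set {poly A}) m : D m -> ~ D 0 ->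
  (forall g, D g -> (size m <= size g)%N) ->
  (forall g c k, D g -> p c -> D (g - c%:P * 'X^k)) ->
  ~ p (lead_coef m).
Proof.
move=> Dm D0 minm stab plead.
have m0 : m != 0 by apply/eqP => m0; apply: D0; rewrite -m0.
have /minm := stab _ _ (size m).-1 Dm plead.
set m1 := m - _; have le1 : (size m1 <= (size m).-1)%N.
  apply/leq_sizeP => j; rewrite leq_eqVlt => /orP[/eqP <-|ltj].
    by rewrite coefB coefCM coefXn eqxx mulr1 lead_coefE subrr.
  rewrite coefB coefCM coefXn gtn_eqF // mulr0 subr0 nth_default //.
  by move: ltj; case: (size m).
by rewrite leqNgt (leq_ltn_trans le1) // ltn_predL size_poly_gt0.
Qed.

(** Over the fraction field of the quotient by [p], either [q] is zero, and any
[xi] will do that is not a root of [v], or [q] is generated by an irreducible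
[m] of least degree, and [xi] must be a root of [m].  Clearing denominators
costs powers of the leading coefficient of [m].  As [v] is prime to [m],
a combination of the two is a constant [d] outside [p], and [v] stays
nonzero at the common zeros of [q] as long as [d] does not vanish.  So
[u] is the product of these two constants. *)
Lemma prime_ideal_extend (C : closedFieldType) (v : {poly A}) : ~ q v ->
  exists2 u : A, ~ q u%:P & forall phi : {rmorphism A -> C},
    (forall a, q a%:P -> phi a = 0) -> phi u != 0 ->
    exists2 xi, (forall g, q g -> (map_poly phi g).[xi] = 0)
      & (map_poly phi v).[xi] != 0.
Proof.
move=> qv.
have phiX (phi : {rmorphism A -> C}) g : (forall a, p a -> phi a = 0) ->
    pX g -> map_poly phi g = 0.
  by move=> phip pXg; apply/polyP => i; rewrite coef_map coef0 /= phip.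
have p1 : ~ p 1 by move=> p1; apply: qv; rewrite -[v]mul1r; apply: primeM.
set D1 := [set g | q g /\ ~ pX g].
(* The exceptional branch is the transcendental case: q is p[X]. *)
have [/min_size_poly[m Dm minm]|D1e] := pselect (D1 !=set0); last first.
  have qpX g : q g -> pX g.
    by move=> qg; apply: contrapT => npX; apply: D1e; exists g.
  have /existsNP[i pvi] : ~ pX v by move=> /pX_q.
  exists v`_i => // phi phip phiu.
  have : map_poly phi v != 0.
    apply/eqP => /polyP/(_ i); rewrite coef_map coef0 /=.
    by move=> eq0; rewrite eq0 eqxx in phiu.
  case/closed_nonrootP => xi; rewrite /root => nroot; exists xi => // g /qpX.
  by move=> /phiX -> //; rewrite horner0.
have [qm npXm] := Dm.
have pc : ~ p (lead_coef m).
  apply: min_lead Dm _ minm _.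
    by case=> _; apply=> i; rewrite coef0; apply: prime0.
  move=> g c k [qg npXg] pc; have pXc : pX (c%:P * 'X^k).
    by apply: pXM => i; rewrite coefC; case: eqP => // _; apply: prime0.
  split; first by apply: primeB => //; apply: pX_q.
  by move=> pXg; apply: npXg; rewrite -[g](subrK (c%:P * 'X^k)); apply: pXD.
have m0 : m != 0.
  by apply/eqP => m0; apply: pc; rewrite m0 lead_coef0; apply: prime0.
have pXsmall g : q g -> (size g < size m)%N -> pX g.
  move=> qg ltg; apply: contrapT => npXg.
  by have := minm _ (conj qg npXg); rewrite leqNgt ltg.
have qdiv g : q g -> exists k s r,
    (lead_coef m ^+ k)%:P * g = s * m + r /\ pX r.
  move=> qg; have [k [s [r [eqg ltr _]]]] := pseudo_division g m0.
  exists k, s, r; split=> //; apply: pXsmall => //.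
  have -> : r = (lead_coef m ^+ k)%:P * g - s * m.
    by rewrite eqg addrC addKr.
  by apply: primeB => //; apply: primeMl.
have qC c : ~ p c -> forall k, ~ q (c ^+ k)%:P.
  by move=> npc k qck; apply: npc; apply: (primeX pr_p p1 (k := k)).
(* The multiples of v modulo q that are not in q: least degree gives a gcd of
   v and m. *)
set D2 := [set w | ~ q w /\ exists a, q (w - a * v)].
have D2min : D2 !=set0 by exists v; split=> //; exists 1;
  rewrite mul1r subrr; apply: prime0.
have [w Dw minw] := min_size_poly D2min.
have [qw [a qwa]] := Dw.
have pe : ~ p (lead_coef w).
  apply: min_lead Dw _ minw _; first by case=> nq0 _; apply: nq0; apply: prime0.
  move=> g c k [qg [b qgb]] pc'; have qcX : q (c%:P * 'X^k) by apply: primeM.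
  split; last by exists b; rewrite addrAC; apply: primeB.
  by move=> qg'; apply: qg; rewrite -[g](subrK (c%:P * 'X^k)); apply: primeD.
have w0 : w != 0.
  by apply/eqP => w0; apply: pe; rewrite w0 lead_coef0; apply: prime0.
have ltwm : (size w < size m)%N.
  have [k [s [r [eqv ltr _]]]] := pseudo_division v m0.
  apply: leq_ltn_trans ltr; apply: minw; split; last first.
    exists (lead_coef m ^+ k)%:P.
    have -> : r - (lead_coef m ^+ k)%:P * v = - (s * m) by rewrite eqv; ring.
    by apply: primeN => //; apply: primeMl.
  move=> qr; have : q ((lead_coef m ^+ k)%:P * v).
    by rewrite eqv; apply: primeD => //; apply: primeMl.
  by case/(primeP pr_q) => // /(qC _ pc k).
(* If w had positive degree, m = s w modulo p[X] would be a proper factorization;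
   q being prime, it contains s, which is too short to be outside p[X]. *)
have w1 : size w = 1%N.
  apply/eqP; rewrite eqn_leq size_poly_gt0 w0 andbT leqNgt; apply/negP => gt1.
  have [k [s [r [eqm ltr les]]]] := pseudo_division m w0.
  have qr : q r.
    apply: contrapT => nqr; move: ltr; apply/negP; rewrite -leqNgt; apply: minw.
    split=> //; exists (- s * a).
    have -> : r - - s * a * v = (lead_coef w ^+ k)%:P * m - s * (w - a * v).
      by rewrite eqm; ring.
    by apply: primeB => //; apply: primeMl.
  have : q (s * w).
    have -> : s * w = (lead_coef w ^+ k)%:P * m - r by rewrite eqm addrK.
    by apply: primeB => //; apply: primeMl.
  case/(primeP pr_q) => // qs.
  have pXm : pX ((lead_coef w ^+ k)%:P * m).
    rewrite eqm; apply: pXD; last by apply: pXsmall => //; apply: ltn_trans ltwm.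
    apply: pXM; apply: pXsmall => //.
    move: gt1 ltwm les; move: (size s) (size w) (size m); lia.
  apply: npXm => i; have := pXm i; rewrite coefCM => /(primeP pr_p)[] //.
  by move/(primeX pr_p p1).
have /size_poly1P[d d0 wE] : size w == 1%N by rewrite w1.
have npd : ~ p d by rewrite /p /= -wE.
exists (lead_coef m * d).
  by move/(primeP pr_p); case.
move=> phi phip; rewrite rmorphM mulf_eq0 negb_or => /andP[phic phid].
have : size (map_poly phi m) != 1%N.
  rewrite size_map_poly_id0 //; apply/eqP => m1; move: ltwm.
  by rewrite m1 w1.
case/closed_rootP => xi /eqP mxi.
have qxi g : q g -> (map_poly phi g).[xi] = 0.
  move=> /qdiv[k [s [r [eqg pXr]]]].
  have := congr1 (fun g => (map_poly phi g).[xi]) eqg.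
  rewrite /= rmorphM rmorphD rmorphM /= (phiX _ _ phip pXr) map_polyC /= rmorphXn.
  rewrite /= !hornerE mxi mulr0.
  by move/eqP; rewrite mulf_eq0 expf_eq0 (negPf phic) andbF => /eqP.
exists xi => //; apply/eqP => vxi; have := qxi _ qwa.
rewrite rmorphB rmorphM /= wE map_polyC !hornerE vxi mulr0 subr0 => /eqP.
by rewrite (negPf phid).
Qed.
End OneVariable.

(** * The Nullstellensatz over an algebraically closed field *)

Section Nullstellensatz.
Variables (F : fieldType) (C : closedFieldType) (j : {rmorphism F -> C}).

(** Every prime ideal is an intersection of kernels of [F]-homomorphisms to [C]. *)
Definition points_separate (A : comNzRingType) (tau : F -> A) :=
  forall (p : set A) (v : A), prime_ideal p -> ~ p v ->
  exists phi : {rmorphism A -> C}, [/\ forall c, phi (tau c) = j c,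
    forall a, p a -> phi a = 0 & phi v != 0].

Lemma points_separate_base : points_separate (id : F -> F).
Proof.
move=> p v pr_p pv; exists j; split=> // [a pa|].
  have [->|a0] := eqVneq a 0; first by rewrite rmorph0.
  by case: pv; rewrite -[v](mulVKf a0); apply: primeM.
rewrite fmorph_eq0; apply/eqP => v0; apply: pv; rewrite v0; exact: prime0.
Qed.

Lemma points_separate_poly (A : comNzRingType) (tau : F -> A) :
  points_separate tau -> points_separate (polyC \o tau).
Proof.
move=> sepA q v pr_q qv; have [u qu ext] := prime_ideal_extend pr_q C qv.
have pr_p := prime_preim (polyC : {rmorphism A -> {poly A}}) pr_q.
have [phi [phij phip phiu]] := sepA _ _ pr_p qu.
have [xi xiq xiv] := ext phi phip phiu.
exists (horner_eval xi \o map_poly phi : {rmorphism {poly A} -> C}).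
split=> // c; by rewrite /= /horner_eval map_polyC hornerC /= phij.
Qed.

(** Transports the property along the isomorphism between polynomials in [n.+1]
variables and polynomials in one variable over those in [n] variables. *)
Lemma points_separate_retract (A B : comNzRingType) (tau : F -> A)
    (sigma : F -> B) (s : {rmorphism B -> A}) (r : {rmorphism A -> B}) :
  cancel s r -> (forall c, s (sigma c) = tau c) ->
  points_separate tau -> points_separate sigma.
Proof.
move=> sK sC sepA p v pr_p pv.
have [|phi [phij phip phiv]] := sepA _ (s v) (prime_preim r pr_p).
  by rewrite /= sK.
exists (phi \o s : {rmorphism B -> C}); split=> //= [c|b pb].
  by rewrite sC.
by apply: phip; rewrite /= sK.
Qed.

Lemma points_separate_mpoly n : points_separate (@mpolyC n F).
Proof.
elim: n => [|n IHn].
  apply: (points_separate_retract (s := meval (fun=> 0)) (r := @mpolyC 0 F) _ _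
    points_separate_base) => [p|c]; last exact: mevalC.
  rewrite /= mevalE raddf_sum [RHS]mpolyE; apply: eq_bigr => m _ /=.
  have -> : m = 0%MM by apply/mnmP => -[].
  by rewrite big_ord0 mulr1 mpolyX0 -mul_mpolyC mulr1.
apply: (points_separate_retract (s := @muni n F)
  (r := horner_eval 'X_ord_max \o map_poly (@mwiden n F)) _ _
  (points_separate_poly IHn)) => [p|c]; last exact: muniC.
rewrite /= muniE [RHS]mpolyE raddf_sum /horner_eval /= horner_sum.
apply: eq_bigr => m _.
rewrite map_polyZ map_polyXn hornerZ hornerXn /= mwidenZ mwidenX -scalerAl.
rewrite mpolyXn -mpolyXD; congr (_ *: 'X_[_]); apply/mnmP => i.
rewrite mnmDE mulmnE mnm1E; have [k ->|->] := unliftP ord_max i.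
  have -> : lift ord_max k = widen_ord (leqnSn n) k.
    by apply/val_inj; rewrite /= /bump leqNgt ltn_ord.
  by rewrite mnmwiden_widen mnmE -val_eqE /= gtn_eqF ?ltn_ord // addn0.
by rewrite mnmwiden_ordmax eqxx mul1n.
Qed.

(** Unlike the textbook form, the polynomials have coefficients in a field [F]
and the points have coordinates in an algebraically closed field [C] over it. *)
Theorem mpoly_nullstellensatz n (p : set {mpoly F[n]}) (v : {mpoly F[n]}) :
  prime_ideal p -> ~ p v -> exists2 z : 'I_n -> C,
    (forall f, p f -> mmap j z f = 0) & mmap j z v != 0.
Proof.
move=> pr_p pv; have [phi [phij phip phiv]] := points_separate_mpoly pr_p pv.
have phiE f : phi f = mmap j (fun i => phi 'X_i) f.
  rewrite {1}[f]mpolyE raddf_sum; apply: eq_bigr => m _ /=.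
  rewrite -mul_mpolyC rmorphM phij mpolyXE_id rmorph_prod; congr (_ * _).
  by apply: eq_bigr => i _; rewrite rmorphXn.
exists (fun i => phi 'X_i); last by rewrite -phiE.
by move=> f /phip; rewrite phiE.
Qed.

End Nullstellensatz.

(** * Slice polynomials as quaternions over the real polynomials *)

Section QuatMorphisms.
Variable R : realType.
Implicit Types x y K : quat R.

HB.instance Definition _ := GRing.isAdditive.Build (quat R) R (@qr R)
  (fun x y => erefl).
HB.instance Definition _ := GRing.isAdditive.Build (quat R) R (@qi R)
  (fun x y => erefl).
HB.instance Definition _ := GRing.isAdditive.Build (quat R) R (@qj R)
  (fun x y => erefl).
HB.instance Definition _ := GRing.isAdditive.Build (quat R) R (@qk R)
  (fun x y => erefl).

Lemma quat_conj_is_additive : additive (@quat_conj R).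
Proof. by move=> x y; apply: quat_eqP => //=; rewrite opprD. Qed.
HB.instance Definition _ := GRing.isAdditive.Build (quat R) (quat R)
  (@quat_conj R) quat_conj_is_additive.

Lemma quat_real_is_additive : additive (@quat_real R).
Proof. by move=> a b; apply: quat_eqP; rewrite //= subrr. Qed.
Lemma quat_real_is_multiplicative : multiplicative (@quat_real R).
Proof. by split=> [a b|//]; apply: quat_eqP => /=; ring. Qed.
HB.instance Definition _ := GRing.isAdditive.Build R (quat R)
  (@quat_real R) quat_real_is_additive.
HB.instance Definition _ := GRing.isMultiplicative.Build R (quat R)
  (@quat_real R) quat_real_is_multiplicative.

Lemma quat_real_central a x : quat_real a * x = x * quat_real a.
Proof. by apply: quat_eqP => /=; ring. Qed.

Lemma quat_mul_conj x : x * quat_conj x = quat_real (quat_sqnorm x).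
Proof. by apply: quat_eqP; rewrite /quat_sqnorm /=; ring. Qed.

End QuatMorphisms.

Section Components.
Variables (R : realType) (n : nat).
Implicit Types (P Q : slice_poly R n) (f : {mpoly R[n]}).

Definition comp_r : slice_poly R n -> {mpoly R[n]} := map_mpoly (@qr R).
Definition comp_i : slice_poly R n -> {mpoly R[n]} := map_mpoly (@qi R).
Definition comp_j : slice_poly R n -> {mpoly R[n]} := map_mpoly (@qj R).
Definition comp_k : slice_poly R n -> {mpoly R[n]} := map_mpoly (@qk R).
Definition of_real : {mpoly R[n]} -> slice_poly R n := map_mpoly (@quat_real R).

HB.instance Definition _ := GRing.Additive.on comp_r.
HB.instance Definition _ := GRing.Additive.on comp_i.
HB.instance Definition _ := GRing.Additive.on comp_j.
HB.instance Definition _ := GRing.Additive.on comp_k.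
HB.instance Definition _ := GRing.RMorphism.on of_real.

Lemma slice_poly_eqP P Q : comp_r P = comp_r Q -> comp_i P = comp_i Q ->
  comp_j P = comp_j Q -> comp_k P = comp_k Q -> P = Q.
Proof.
move=> /mpolyP er /mpolyP ei /mpolyP ej /mpolyP ek; apply/mpolyP => m.
by apply: quat_eqP; rewrite -!mcoeff_map_mpoly.
Qed.

Lemma comp_rM P Q : comp_r (P * Q) = comp_r P * comp_r Q - comp_i P * comp_i Q
  - comp_j P * comp_j Q - comp_k P * comp_k Q.
Proof.
apply/mpolyP => m; rewrite mcoeff_map_mpoly mcoeffM raddf_sum.
rewrite mcoeffB mcoeffB mcoeffB !mcoeffM.
rewrite -!sumrB; apply: eq_bigr => k _.
by rewrite !mcoeff_map_mpoly.
Qed.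

Lemma comp_iM P Q : comp_i (P * Q) = comp_r P * comp_i Q + comp_i P * comp_r Q
  + comp_j P * comp_k Q - comp_k P * comp_j Q.
Proof.
apply/mpolyP => m; rewrite mcoeff_map_mpoly mcoeffM raddf_sum.
rewrite mcoeffB mcoeffD mcoeffD !mcoeffM.
rewrite -!big_split -sumrB; apply: eq_bigr => k _.
by rewrite !mcoeff_map_mpoly.
Qed.

Lemma comp_jM P Q : comp_j (P * Q) = comp_r P * comp_j Q - comp_i P * comp_k Q
  + comp_j P * comp_r Q + comp_k P * comp_i Q.
Proof.
apply/mpolyP => m; rewrite mcoeff_map_mpoly mcoeffM raddf_sum.
rewrite mcoeffD mcoeffD mcoeffB !mcoeffM.
rewrite -sumrB -!big_split; apply: eq_bigr => k _.
by rewrite !mcoeff_map_mpoly.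
Qed.

Lemma comp_kM P Q : comp_k (P * Q) = comp_r P * comp_k Q + comp_i P * comp_j Q
  - comp_j P * comp_i Q + comp_k P * comp_r Q.
Proof.
apply/mpolyP => m; rewrite mcoeff_map_mpoly mcoeffM raddf_sum.
rewrite mcoeffD mcoeffB mcoeffD !mcoeffM.
rewrite -big_split -sumrB -big_split; apply: eq_bigr => k _.
by rewrite !mcoeff_map_mpoly.
Qed.

Definition compM := (comp_rM, comp_iM, comp_jM, comp_kM).

Lemma comp_r_real f : comp_r (of_real f) = f.
Proof. by apply/mpolyP => m; rewrite !mcoeff_map_mpoly. Qed.
Lemma comp_i_real f : comp_i (of_real f) = 0.
Proof. by apply/mpolyP => m; rewrite !mcoeff_map_mpoly mcoeff0. Qed.
Lemma comp_j_real f : comp_j (of_real f) = 0.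
Proof. by apply/mpolyP => m; rewrite !mcoeff_map_mpoly mcoeff0. Qed.
Lemma comp_k_real f : comp_k (of_real f) = 0.
Proof. by apply/mpolyP => m; rewrite !mcoeff_map_mpoly mcoeff0. Qed.

Lemma reg_conjE P : reg_conj P = map_mpoly (@quat_conj R) P.
Proof.
rewrite /reg_conj [RHS]/map_mpoly /mmap; apply: eq_bigr => m _.
by rewrite mmap1_id mul_mpolyC.
Qed.

Lemma comp_r_conj P : comp_r (reg_conj P) = comp_r P.
Proof. by rewrite reg_conjE; apply/mpolyP => m; rewrite !mcoeff_map_mpoly. Qed.
Lemma comp_i_conj P : comp_i (reg_conj P) = - comp_i P.
Proof.
by rewrite reg_conjE; apply/mpolyP => m; rewrite mcoeffN !mcoeff_map_mpoly.
Qed.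
Lemma comp_j_conj P : comp_j (reg_conj P) = - comp_j P.
Proof.
by rewrite reg_conjE; apply/mpolyP => m; rewrite mcoeffN !mcoeff_map_mpoly.
Qed.
Lemma comp_k_conj P : comp_k (reg_conj P) = - comp_k P.
Proof.
by rewrite reg_conjE; apply/mpolyP => m; rewrite mcoeffN !mcoeff_map_mpoly.
Qed.

Lemma comp_r_const c : comp_r c%:MP = (qr c)%:MP.
Proof. exact: map_mpolyC. Qed.
Lemma comp_i_const c : comp_i c%:MP = (qi c)%:MP.
Proof. exact: map_mpolyC. Qed.
Lemma comp_j_const c : comp_j c%:MP = (qj c)%:MP.
Proof. exact: map_mpolyC. Qed.
Lemma comp_k_const c : comp_k c%:MP = (qk c)%:MP.
Proof. exact: map_mpolyC. Qed.

Definition comp_realE := (comp_r_real, comp_i_real, comp_j_real, comp_k_real).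
Definition comp_conjE := (comp_r_conj, comp_i_conj, comp_j_conj, comp_k_conj).
Definition comp_constE := (comp_r_const, comp_i_const, comp_j_const, comp_k_const).
Definition compE := (comp_realE, comp_conjE, comp_constE, compM).

Lemma of_real_central f P : of_real f * P = P * of_real f.
Proof. by apply: slice_poly_eqP; rewrite !compE; ring. Qed.

(** The norm form of the quaternions over the real polynomials. *)
Definition mnorm P : {mpoly R[n]} :=
  comp_r P ^+ 2 + comp_i P ^+ 2 + comp_j P ^+ 2 + comp_k P ^+ 2.

Lemma mul_reg_conj P : P * reg_conj P = of_real (mnorm P).
Proof. by apply: slice_poly_eqP; rewrite comp_realE compM !comp_conjE /mnorm; ring. Qed.

Lemma reg_conj_mul P : reg_conj P * P = of_real (mnorm P).
Proof. by apply: slice_poly_eqP; rewrite comp_realE compM !comp_conjE /mnorm; ring. Qed.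

Lemma reg_conjK : involutive (@reg_conj R n).
Proof. by move=> P; apply: slice_poly_eqP; rewrite !comp_conjE ?opprK. Qed.

Lemma add_reg_conj P : P + reg_conj P = of_real (comp_r P *+ 2).
Proof. by apply: slice_poly_eqP; rewrite comp_realE raddfD /= !comp_conjE; ring. Qed.

Lemma reg_conjM P Q : reg_conj (P * Q) = reg_conj Q * reg_conj P.
Proof.
by apply: slice_poly_eqP; rewrite comp_conjE !compM !comp_conjE; ring.
Qed.

End Components.

(** * Specialization at a complex point *)

Section Hamilton.
Variables (R : realType) (A : comNzRingType) (phi : {rmorphism A -> R[i]}).
Variables a b c d a' b' c' d' : A.

Let X := [:: a * a' - b * b' - c * c' - d * d';
  a * b' + b * a' + c * d' - d * c';
  a * c' - b * d' + c * a' + d * b'; a * d' + b * c' - c * b' + d * a'].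

Let prR := Quat (Re (phi X`_0)) (Re (phi X`_1)) (Re (phi X`_2)) (Re (phi X`_3)).
Let prI := Quat (Im (phi X`_0)) (Im (phi X`_1)) (Im (phi X`_2)) (Im (phi X`_3)).
Let xR := Quat (Re (phi a)) (Re (phi b)) (Re (phi c)) (Re (phi d)).
Let xI := Quat (Im (phi a)) (Im (phi b)) (Im (phi c)) (Im (phi d)).
Let yR := Quat (Re (phi a')) (Re (phi b')) (Re (phi c')) (Re (phi d')).
Let yI := Quat (Im (phi a')) (Im (phi b')) (Im (phi c')) (Im (phi d')).

(** The product of quaternions over [A], specialized by [phi], is the product of
complexified quaternions, written here by real and imaginary parts.  Working
over an abstract [A] keeps the terms free of polynomials. *)
Lemma rmorph_hamilton : prR = xR * yR - xI * yI /\ prI = xR * yI + xI * yR.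
Proof.
rewrite /prR /prI /xR /xI /yR /yI /= !(rmorphB, rmorphD, rmorphM) /=.
move: (phi a) (phi b) (phi c) (phi d) => [? ?] [? ?] [? ?] [? ?].
move: (phi a') (phi b') (phi c') (phi d') => [? ?] [? ?] [? ?] [? ?].
by split; apply: quat_eqP => /=; ring.
Qed.

End Hamilton.

Section Evaluation.
Variables (R : realType) (n : nat) (z : 'I_n -> R[i]).
Implicit Types (P Q : slice_poly R n) (f : {mpoly R[n]}) (K : quat R).

Definition ev : {mpoly R[n]} -> R[i] := mmap (real_complex R) z.
HB.instance Definition _ := GRing.RMorphism.on ev.

(** [ev_re z P + iota ev_im z P] is the value of [P] at [z] in the complexified
quaternions, [iota] being the central imaginary unit. *)
Definition ev_re P : quat R := Quat (Re (ev (comp_r P))) (Re (ev (comp_i P)))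
  (Re (ev (comp_j P))) (Re (ev (comp_k P))).
Definition ev_im P : quat R := Quat (Im (ev (comp_r P))) (Im (ev (comp_i P)))
  (Im (ev (comp_j P))) (Im (ev (comp_k P))).

Lemma ReD (x y : R[i]) : Re (x + y) = Re x + Re y. Proof. by case: x y => ? ? []. Qed.
Lemma ImD (x y : R[i]) : Im (x + y) = Im x + Im y. Proof. by case: x y => ? ? []. Qed.
Lemma ReN (x : R[i]) : Re (- x) = - Re x. Proof. by case: x. Qed.
Lemma ImN (x : R[i]) : Im (- x) = - Im x. Proof. by case: x. Qed.
Lemma ReM (x y : R[i]) : Re (x * y) = Re x * Re y - Im x * Im y.
Proof. by case: x y => ? ? []. Qed.
Lemma ImM (x y : R[i]) : Im (x * y) = Re x * Im y + Im x * Re y.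
Proof. by case: x y => ? ? []. Qed.
Definition ReImE := (ReD, ImD, ReN, ImN, ReM, ImM).

Lemma ev_re_additive : additive ev_re.
Proof. by move=> P Q; apply: quat_eqP; rewrite /= !raddfB. Qed.
Lemma ev_im_additive : additive ev_im.
Proof. by move=> P Q; apply: quat_eqP; rewrite /= !raddfB. Qed.
HB.instance Definition _ := GRing.isAdditive.Build (slice_poly R n) (quat R)
  ev_re ev_re_additive.
HB.instance Definition _ := GRing.isAdditive.Build (slice_poly R n) (quat R)
  ev_im ev_im_additive.

Lemma ev_reM P Q : ev_re (P * Q) = ev_re P * ev_re Q - ev_im P * ev_im Q.
Proof. rewrite /ev_re /ev_im !compM; exact: (rmorph_hamilton ev _ _ _ _ _ _ _ _).1. Qed.
Lemma ev_imM P Q : ev_im (P * Q) = ev_re P * ev_im Q + ev_im P * ev_re Q.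
Proof. rewrite /ev_re /ev_im !compM; exact: (rmorph_hamilton ev _ _ _ _ _ _ _ _).2. Qed.

Lemma ev_mul_eq0 P Q : ev_re P = 0 /\ ev_im P = 0 ->
  ev_re (P * Q) = 0 /\ ev_im (P * Q) = 0.
Proof. by move=> [r0 i0]; rewrite ev_reM ev_imM r0 i0 !mul0r subr0 addr0. Qed.

Lemma ev_reg_conj P : ev_re (reg_conj P) = quat_conj (ev_re P) /\
  ev_im (reg_conj P) = quat_conj (ev_im P).
Proof. by split; apply: quat_eqP; rewrite /= !comp_conjE ?raddfN ?ReImE. Qed.

Lemma ev_of_real f : ev_re (of_real f) = quat_real (Re (ev f)) /\
  ev_im (of_real f) = quat_real (Im (ev f)).
Proof. by split; apply: quat_eqP; rewrite /= !comp_realE ?raddf0. Qed.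

Definition slice_embed K (w : R[i]) : quat R :=
  quat_real (Re w) + quat_real (Im w) * K.

Lemma slice_embedM K w1 w2 : quat_sphere K ->
  slice_embed K (w1 * w2) = slice_embed K w1 * slice_embed K w2.
Proof.
rewrite /quat_sphere /slice_embed /= !ReImE => K2.
set a1 := Re w1; set b1 := Im w1; set a2 := Re w2; set b2 := Im w2.
have -> : (quat_real a1 + quat_real b1 * K) * (quat_real a2 + quat_real b2 * K) =
    quat_real (a1 * a2) + quat_real (a1 * b2 + b1 * a2) * K
    + quat_real (b1 * b2) * K ^+ 2.
  by apply: quat_eqP; rewrite /=; ring.
by rewrite K2; apply: quat_eqP; rewrite /=; ring.
Qed.

Lemma slice_embed1 K : slice_embed K 1 = 1.
Proof. by rewrite /slice_embed /= mul0r addr0. Qed.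

Lemma slice_embed_monomial K m : quat_sphere K ->
  \prod_(i < n) slice_embed K (z i) ^+ m i =
  slice_embed K (\prod_(i < n) z i ^+ m i).
Proof.
move=> SK; rewrite (big_morph (slice_embed K) (id1 := 1) (op1 := *%R)).
- apply: eq_bigr => i _; elim: (m i) => [|k IHk]; first by rewrite slice_embed1.
  by rewrite !exprS slice_embedM // IHk.
- by move=> w1 w2; apply: slice_embedM.
- exact: slice_embed1.
Qed.

(** The powers of the variables take values in the commutative field spanned by 1
and [K], so evaluation replaces [iota] by [K], on the left of the coefficients. *)
Lemma slice_eval_embed K P : quat_sphere K ->
  slice_eval P (fun i => slice_embed K (z i)) = ev_re P + K * ev_im P.
Proof.
move=> SK; rewrite {2 3}[P]mpolyE !raddf_sum mulr_sumr -big_split /=.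
apply: eq_bigr => m _; rewrite slice_embed_monomial // mulrDl.
have monE (g : {additive quat R -> R}) :
    ev (map_mpoly g (P@_m *: 'X_[m])) = (g P@_m)%:C%C * \prod_(i < n) z i ^+ m i.
  have -> : map_mpoly g (P@_m *: 'X_[m]) = g P@_m *: 'X_[m].
    apply/mpolyP => m'; rewrite mcoeff_map_mpoly !mcoeffZ !mcoeffX.
    by case: eqP => _; rewrite ?mulr1 ?mulr0 ?raddf0.
  by rewrite /ev mmapZ mmapX.
rewrite /ev_re /ev_im !monE; move: (\prod_(i < n) _) => [a b].
by apply: quat_eqP => /=; ring.
Qed.

End Evaluation.

(** * Right ideals of the complexified quaternions *)

Section ComplexQuaternions.
Variable R : realType.
Implicit Types a b x y K : quat R.

Lemma quat_unitE x : (x \is a GRing.unit) = (x != 0).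
Proof. by []. Qed.

Lemma quat_conj_eq0 x : (quat_conj x == 0) = (x == 0).
Proof. by rewrite -!quat_sqnorm_eq0 /quat_sqnorm /= !sqrrN. Qed.

(** If [a + K b = 0] for two opposite [K], then [a] and [b] are zero. *)
Lemma separating_slice a b : ~ (a = 0 /\ b = 0) ->
  exists2 K, quat_sphere K & a + K * b != 0.
Proof.
move=> ab0; pose i : quat R := Quat 0 1 0 0.
have i2 : i ^+ 2 = -1 by apply: quat_eqP => /=; ring.
have [eq0|] := eqVneq (a + i * b) 0; last by exists i.
exists (- i); first by rewrite /quat_sphere /= sqrrN.
apply/eqP => eq0'; apply: ab0.
move: eq0 eq0'; rewrite /i; case: a b => [a0 a1 a2 a3] [b0 b1 b2 b3].
by case=> ? ? ? ? [? ? ? ?]; split; apply: quat_eqP => /=; lra.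
Qed.

(** The hypotheses say that [a + iota b] is nonzero of norm zero in the
complexified quaternions; its right annihilator is the set of [x + iota y] with
[x + K y = 0] for [K = - a^-1 b], which is imaginary of norm one. *)
Lemma isotropic_slice a b : a * quat_conj a = b * quat_conj b ->
  a * quat_conj b + b * quat_conj a = 0 -> ~ (a = 0 /\ b = 0) ->
  exists2 K, quat_sphere K & forall x y,
    a * x - b * y = 0 /\ a * y + b * x = 0 <-> x + K * y = 0.
Proof.
move=> eqN eqT ab0.
have a0 : a != 0.
  apply/eqP => a0; apply: ab0; split=> //; apply/eqP.
  move: eqN; rewrite a0 mul0r quat_mul_conj => /esym/(congr1 (@qr R)) /= /eqP.
  by rewrite quat_sqnorm_eq0.
have ua : a \is a GRing.unit by [].
have uca : quat_conj a \is a GRing.unit by rewrite quat_unitE quat_conj_eq0.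
pose K := - (a^-1 * b).
have aK : a * K = - b by rewrite mulrN mulVKr.
have SK : K * K = - 1.
  have bE : a^-1 * b = - (quat_conj b * (quat_conj a)^-1).
    apply: (mulIr uca); apply: (mulrI ua); rewrite mulNr !mulrA divrr // mul1r.
    by rewrite mulrN -mulrA mulVr // mulr1; apply/eqP; rewrite -addr_eq0 addrC eqT.
  rewrite mulrNN {2}bE mulrN !mulrA -(mulrA _ b) -eqN !mulrA mulVr // mul1r.
  by rewrite divrr.
exists K; first by rewrite /quat_sphere /= expr2.
move=> x y; split=> [[+ _]|/eqP].
  move=> eq0; apply: (mulrI ua).
  by rewrite mulrDr mulrA aK mulNr eq0 mulr0.
rewrite addr_eq0 => /eqP ->; split.
  by rewrite mulrN mulrA aK mulNr opprK subrr.
rewrite mulrN; have -> : b = - (a * K) by rewrite aK opprK.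
by rewrite mulNr opprK -mulrA [K * (K * y)]mulrA SK mulN1r mulrN subrr.
Qed.

End ComplexQuaternions.

(** * Points of completely prime right ideals *)

Section CompletelyPrime.
Variables (R : realType) (n : nat) (J : set (slice_poly R n)).
Hypotheses (idJ : right_ideal J) (cpJ : completely_prime J).
Implicit Types (P Q S T X Y : slice_poly R n).

Let p : set {mpoly R[n]} := [set f | J (of_real f)].

Let J0 : J 0. Proof. by case: idJ. Qed.
Let JD P Q : J P -> J Q -> J (P + Q). Proof. by case: idJ => _ + _; apply. Qed.
Let JM P Q : J P -> J (P * Q). Proof. by case: idJ => _ _; apply. Qed.
Let JB P Q : J P -> J Q -> J (P - Q).
Proof. by move=> JP JQ; apply: JD => //; rewrite -mulrN1; apply: JM. Qed.

(** Real polynomials multiply [J] into itself, being central; this is where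
complete primeness applies. *)
Let central_prime f Q : J (of_real f * Q) -> p f \/ J Q.
Proof.
by move=> /cpJ; apply=> S JS; rewrite of_real_central; apply: JM.
Qed.

Let pr_p : prime_ideal p.
Proof.
split=> [|f g|f g|f g]; rewrite /p /= ?rmorph0 ?rmorphD ?rmorphM.
- exact: J0.
- exact: JD.
- exact: JM.
- exact: central_prime.
Qed.

Let half f : p (f *+ 2) -> p f.
Proof.
move=> pf; have -> : f = f *+ 2 * (2%:R^-1)%:MP.
  rewrite -[f *+ 2]mulr_natr -mulrA -mpolyC_nat -mpolyCM divff ?pnatr_eq0 //.
    by rewrite mpolyC1 mulr1.
exact: primeM.
Qed.

(** The two-sided ideal generated by [p], described by the trace form. *)
Let M : set (slice_poly R n) := [set S | forall c, p (comp_r (S * c%:MP))].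

Let M_comp S : M S -> [/\ p (comp_r S), p (comp_i S), p (comp_j S) & p (comp_k S)].
Proof.
move=> MS.
have h c : p (comp_r S * (qr c)%:MP - comp_i S * (qi c)%:MP
    - comp_j S * (qj c)%:MP - comp_k S * (qk c)%:MP).
  by have := MS c; rewrite !compE.
split.
- by have := h (Quat 1 0 0 0); rewrite /= !mpolyC0 mpolyC1 !mulr0 !subr0 mulr1.
- have := h (Quat 0 (-1) 0 0); rewrite /= !mpolyC0 mpolyCN mpolyC1 !mulr0 !subr0.
  by rewrite sub0r mulrN1 opprK.
- have := h (Quat 0 0 (-1) 0); rewrite /= !mpolyC0 mpolyCN mpolyC1 !mulr0 !subr0.
  by rewrite sub0r mulrN1 opprK.
- have := h (Quat 0 0 0 (-1)); rewrite /= !mpolyC0 mpolyCN mpolyC1 !mulr0 !subr0.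
  by rewrite sub0r mulrN1 opprK.
Qed.

Let M_J S : M S -> J S.
Proof.
move=> /M_comp[pr pi pj pk].
have -> : S = of_real (comp_r S) + of_real (comp_i S) * (Quat 0 1 0 0)%:MP
    + of_real (comp_j S) * (Quat 0 0 1 0)%:MP
    + of_real (comp_k S) * (Quat 0 0 0 1)%:MP.
  apply: slice_poly_eqP; rewrite !raddfD /= !compE /= !mpolyC0 mpolyC1; ring.
exact: (JD (JD (JD pr (JM _ pi)) (JM _ pj)) (JM _ pk)).
Qed.

(** The Nullstellensatz for [p], applied to a trace [comp_r (S * c)] outside [p]. *)
Let separate S : ~ M S -> exists z : 'I_n -> R[i],
  [/\ forall f, p f -> ev z f = 0,
      forall T, M T -> ev_re z T = 0 /\ ev_im z T = 0
    & ~ (ev_re z S = 0 /\ ev_im z S = 0)].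
Proof.
move=> /existsNP[c pSc].
have [z pz Scz] := mpoly_nullstellensatz (real_complex R) pr_p pSc.
have pz' f : p f -> ev z f = 0 by apply: pz.
exists z; split=> //.
  move=> T /M_comp[pr pi pj pk].
  by split; apply: quat_eqP => /=; rewrite pz'.
move=> /(ev_mul_eq0 c%:MP)[/(congr1 (@qr R))/= r0 /(congr1 (@qr R))/= i0].
by move: Scz; apply/negP; rewrite negbK eq_complex; apply/andP; split; apply/eqP.
Qed.

Let point P (z : 'I_n -> R[i]) K : quat_sphere K ->
  (forall S, J S -> ev_re z S + K * ev_im z S = 0) ->
  ev_re z P + K * ev_im z P <> 0 ->
  exists2 q, slice_zero_set J q & slice_eval P q <> 0.
Proof.
move=> SK Jz Pz; exists (fun i => slice_embed K (z i)); last first.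
  by rewrite slice_eval_embed.
split; first by move=> S JS; rewrite slice_eval_embed //; apply: Jz.
by exists K => // i; exists (Re (z i)), (Im (z i)).
Qed.

(** The key step is [MTc]: [J] is annihilated by [T^c] modulo [p].  If not, some
[T^c Y] in [J] has trace [u] outside [p]; then
[u T^c = T^c Y T^c + N(T) Y^c] is in [J], hence so are [T^c] and the trace
[t = T + T^c], which is outside [p]. *)
Let point_of_trace T P : J T -> ~ p (comp_r T) -> ~ J P ->
  exists2 q, slice_zero_set J q & slice_eval P q <> 0.
Proof.
move=> JT pT JP; pose t := comp_r T *+ 2; have pt : ~ p t by move=> /half.
have trE : of_real t = T + reg_conj T by rewrite add_reg_conj.
have JTc : ~ J (reg_conj T).
  by move=> JTc; apply: pt; rewrite /p /= trE; exact: (JD JT JTc).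
have pN : p (mnorm T) by rewrite /p /= -mul_reg_conj; exact: JM.
have MTc S : J S -> M (reg_conj T * S).
  move=> JS d; apply: contrapT => npd; set Y := S * d%:MP.
  have JY : J Y by exact: JM.
  have JTcY : J (reg_conj T * Y).
    have -> : reg_conj T * Y = Y * of_real t - T * Y.
      by rewrite -of_real_central trE mulrDl [X in X - _]addrC addrK.
    by apply: JB; exact: JM.
  have : J (of_real (comp_r (reg_conj T * Y) *+ 2) * reg_conj T).
    have -> : of_real (comp_r (reg_conj T * Y) *+ 2) * reg_conj T
        = reg_conj T * Y * reg_conj T + of_real (mnorm T) * reg_conj Y.
      rewrite -add_reg_conj reg_conjM reg_conjK mulrDl -[_ * T * _]mulrA.
      by rewrite mul_reg_conj of_real_central.
    by apply: JD; exact: JM.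
  case/central_prime => [/half ptY|]; last exact: JTc.
  by apply: npd; rewrite -mulrA.
(* If T^c P were in J, then t P = T P + T^c P would be too. *)
have MTcP : ~ M (reg_conj T * P).
  move=> /M_J JTcP; have : J (of_real t * P).
    by rewrite trE mulrDl; exact: (JD (JM _ JT) JTcP).
  by case/central_prime; [exact: pt|exact: JP].
have [z [pz Mz TcPz]] := separate MTcP.
have NTc : reg_conj T * reg_conj (reg_conj T) = of_real (mnorm T).
  by rewrite reg_conjK reg_conj_mul.
have := ev_of_real z (mnorm T); rewrite (pz _ pN) -NTc ev_reM ev_imM.
rewrite !(ev_reg_conj z (reg_conj T)).1 !(ev_reg_conj z (reg_conj T)).2.
case=> /subr0_eq eqN eqT.
have [|K SK Kz] := isotropic_slice eqN eqT.
  by move=> /(ev_mul_eq0 P).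
have onK S : ev_re z (reg_conj T * S) = 0 /\ ev_im z (reg_conj T * S) = 0 <->
    ev_re z S + K * ev_im z S = 0.
  by rewrite ev_reM ev_imM; exact: Kz.
apply: (point SK) => [S JS|KzP]; first exact: (onK S).1 (Mz _ (MTc S JS)).
exact: TcPz ((onK P).2 KzP).
Qed.

Lemma completely_prime_point P : ~ J P ->
  exists2 q, slice_zero_set J q & slice_eval P q <> 0.
Proof.
move=> JP; have [JsubM|] := pselect (J `<=` M).
  have [|z [_ Mz /separating_slice[K SK /eqP Pz]]] := @separate P.
    by move=> /M_J.
  by apply: (point SK) Pz => S /JsubM /Mz[-> ->]; rewrite mulr0 addr0.
move=> /existsNP[T /not_implyP[JT /existsNP[c pTc]]].
by apply: point_of_trace pTc JP; exact: JM.
Qed.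

End CompletelyPrime.

(** * Slice zero sets *)

Section ZeroSets.
Variables (R : realType) (n : nat).
Implicit Types (P Q S : slice_poly R n) (q : 'I_n -> quat R) (K : quat R).
Implicit Types I J : set (slice_poly R n).

Definition in_slice q : Prop :=
  exists2 K, quat_sphere K & forall i, quat_slice K (q i).

Lemma slice_zero_setE I q :
  slice_zero_set I q <-> (forall P, I P -> slice_eval P q = 0) /\ in_slice q.
Proof. by []. Qed.

Lemma slice_pointP q : in_slice q -> exists K (z : 'I_n -> R[i]),
  quat_sphere K /\ forall P, slice_eval P q = ev_re z P + K * ev_im z P.
Proof.
case=> K SK qK.
have /choice[z zE] : forall i, exists w, q i = slice_embed K w.
  by move=> i; have [a [b ->]] := qK i; exists (Complex a b).
exists K, z; split=> // P; rewrite -slice_eval_embed //; congr slice_eval.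
exact/funext.
Qed.

Lemma slice_evalD P Q q : in_slice q ->
  slice_eval (P + Q) q = slice_eval P q + slice_eval Q q.
Proof.
by case/slice_pointP => K [z [SK evE]]; rewrite !evE !raddfD /= mulrDr addrACA.
Qed.

Lemma slice_eval1 q : slice_eval (1 : slice_poly R n) q = 1.
Proof.
rewrite /slice_eval msupp1 big_seq1 mcoeff1 eqxx mulr1 big1 // => i _.
by rewrite mnm0E expr0.
Qed.

(** With [e] the value of [P], the value of [P * Q] is [e x + K e y]: the value of
[Q] with [K] replaced by its conjugate by [e], multiplied by [e]. *)
Lemma ev_mul_slice (z : 'I_n -> R[i]) K P Q : quat_sphere K ->
  ev_re z (P * Q) + K * ev_im z (P * Q) =
  (ev_re z P + K * ev_im z P) * ev_re z Q
  + K * ((ev_re z P + K * ev_im z P) * ev_im z Q).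
Proof.
rewrite /quat_sphere /= expr2 ev_reM ev_imM => KK.
move: (ev_re z P) (ev_im z P) (ev_re z Q) (ev_im z Q) => a b x y.
have -> : K * ((a + K * b) * y) = K * (a * y) - b * y.
  by rewrite mulrDl mulrDr -[K * b * y]mulrA [X in _ + X]mulrA KK mulN1r.
rewrite mulrDr mulrDl -[K * b * x]mulrA [K * (a * y) + K * _]addrC addrACA.
by rewrite [- _ + _]addrC.
Qed.

Lemma slice_evalM_eq0 P Q q : in_slice q ->
  slice_eval P q = 0 -> slice_eval (P * Q) q = 0.
Proof.
case/slice_pointP => K [z [SK evE]]; rewrite !evE (ev_mul_slice _ _ _ SK) => ->.
by rewrite !mul0r mulr0 addr0.
Qed.

Lemma slice_embed_eq0 K (w : R[i]) : quat_sphere K ->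
  slice_embed K w = 0 -> w = 0.
Proof.
case: w => a b SK /eqP; rewrite /slice_embed /= addr_eq0 => /eqP aE.
have /(congr1 (@qr R)) : quat_real (a ^+ 2 + b ^+ 2) = 0.
  rewrite rmorphD !rmorphXn /= aE sqrrN exprMn_comm; last exact: quat_real_central.
  by rewrite SK mulrN1 addNr.
move=> /= /eqP; rewrite paddr_eq0 ?sqr_ge0 // !sqrf_eq0 => /andP[/eqP-> /eqP->].
by [].
Qed.

(** [Q] vanishes at the conjugate point in the slice of [K' = e^-1 K e], hence so
does [Q * Q^c], which is the real polynomial [mnorm Q].  Its complex value is
then zero, and does not depend on the slice. *)
Lemma slice_eval_symmetrization P Q q : in_slice q ->
  slice_eval (P * Q) q = 0 -> slice_eval P q <> 0 ->
  slice_eval (symmetrization Q) q = 0.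
Proof.
case/slice_pointP => K [z [SK evE]]; rewrite !evE (ev_mul_slice _ _ _ SK).
set e := ev_re z P + _ => PQ0 /eqP e0.
have ue : e \is a GRing.unit by [].
pose K' := e^-1 * K * e.
have SK' : quat_sphere K'.
  rewrite /quat_sphere /= expr2 /K' !mulrA mulrK //.
  by rewrite -[e^-1 * K * K]mulrA -expr2 SK mulrN1 mulNr mulVr.
have Q0 : ev_re z Q + K' * ev_im z Q = 0.
  apply: (mulrI ue); rewrite mulr0 mulrDr /K' !mulrA divrr // mul1r.
  by rewrite -[K * e * _]mulrA.
have := ev_mul_slice z Q (reg_conj Q) SK'; rewrite Q0 !mul0r mulr0 addr0.
rewrite /symmetrization mul_reg_conj (ev_of_real z _).1 (ev_of_real z _).2.
rewrite -!quat_real_central => /(slice_embed_eq0 SK') ->.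
by rewrite /= mul0r addr0.
Qed.

(** The Nullstellensatz for radical right ideals: a completely prime [J]
containing [I] has its slice zero set inside that of [I]. *)
Lemma radical_eq_vanishing I P : right_ideal I -> is_radical I ->
  (forall q, slice_zero_set I q -> slice_eval P q = 0) -> I P.
Proof.
move=> idI radI vanP; rewrite -radI => J [idJ [cpJ IJ]].
apply: contrapT => JP; have [q [Jq sq] []] := completely_prime_point idJ cpJ JP.
by apply: vanP; split=> // S /IJ; apply: Jq.
Qed.

Definition ideal_adjoin I P : set (slice_poly R n) :=
  [set X | exists2 S, I S & exists Q, X = S + P * Q].

Lemma right_ideal_adjoin I P : right_ideal I -> right_ideal (ideal_adjoin I P).
Proof.
case=> I0 ID IM; split.
- by exists 0 => //; exists 0; rewrite mulr0 addr0.
- move=> _ _ [S IS [Q ->]] [S' IS' [Q' ->]]; exists (S + S'); first exact: ID.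
  by exists (Q + Q'); rewrite mulrDr addrACA.
- move=> _ X [S IS [Q ->]]; exists (S * X); first exact: IM.
  by exists (Q * X); rewrite mulrDl mulrA.
Qed.

Lemma slice_zero_set_adjoin I P q : right_ideal I ->
  slice_zero_set (ideal_adjoin I P) q <->
  slice_zero_set I q /\ slice_eval P q = 0.
Proof.
case=> I0 ID IM; rewrite !slice_zero_setE; split.
  case=> zq sq; split; last by apply: zq; exists 0 => //; exists 1; rewrite add0r mulr1.
  by split=> // S IS; apply: zq; exists S => //; exists 0; rewrite mulr0 addr0.
case=> -[zq sq] Pq; split=> // _ [S IS [Q ->]].
by rewrite slice_evalD // (zq _ IS) slice_evalM_eq0 ?addr0.
Qed.

(** The unit ideal has the empty zero set and the zero ideal the largest one, and
these are comparable with any other. *)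
Lemma incomparable_proper I1 I2 :
  ~ (slice_zero_set I1 `<=` slice_zero_set I2) ->
  ~ (slice_zero_set I2 `<=` slice_zero_set I1) -> proper_nontrivial I1.
Proof.
move=> n12 n21; split=> I1E; [apply: n12|apply: n21] => q; rewrite I1E.
  case=> zq _; have := zq 1 Logic.I; rewrite slice_eval1 => /eqP.
  by rewrite oner_eq0.
by case=> _ sq; split=> // _ ->; rewrite /slice_eval msupp0 big_nil.
Qed.

End ZeroSets.

Theorem theorem5p11 (R : realType) (n : nat) (I : set (slice_poly R n)) :
  right_ideal I -> is_radical I -> irreducible (slice_zero_set I) ->
  quasi_prime I.
Proof.
move=> idI radI irrI P Q IPQ.
set V1 := slice_zero_set (ideal_adjoin I P).
set V2 := slice_zero_set (ideal_adjoin I (symmetrization Q)).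
have VE : slice_zero_set I = V1 `|` V2.
  apply/seteqP; split=> q; last by case=> /slice_zero_set_adjoin[].
  move=> Iq; have [zq sq] := Iq.
  have [P0|P0] := pselect (slice_eval P q = 0).
    by left; apply/slice_zero_set_adjoin.
  right; apply/slice_zero_set_adjoin => //; split=> //.
  exact: slice_eval_symmetrization sq (zq _ IPQ) P0.
have [V21|n21] := pselect (V2 `<=` V1).
  left; apply: radical_eq_vanishing => // q; rewrite VE.
  by case=> [|/V21] /slice_zero_set_adjoin[].
have [V12|n12] := pselect (V1 `<=` V2).
  right; apply: radical_eq_vanishing => // q; rewrite VE.
  by case=> [/V12|] /slice_zero_set_adjoin[].
case: irrI; exists (ideal_adjoin I P), (ideal_adjoin I (symmetrization Q)).
split=> //; (split; first exact: right_ideal_adjoin).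
- exact: incomparable_proper n12 n21.
- exact: incomparable_proper n21 n12.
Qed.
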